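(* Let $a\neq 0$ be a real number and let $F=\{f_1<\cdots<f_k\}$ be a finite set of positive integers. Then the polynomials $c_n^{a;F}$, $n\in\sigma_F$, are common eigenfunctions of the second order difference operator $$D_F=h_{-1}(x)\,\mathfrak{s}_{-1}+h_0(x)\,\mathfrak{s}_0+h_1(x)\,\mathfrak{s}_1,$$ where $$h_{-1}(x)=-x\frac{\Omega_F^a(x+1)}{\Omega_F^a(x)},\qquad h_0(x)=x+k+a+u_F-a\frac{\Lambda_F^a(x+1)}{\Omega_F^a(x+1)}+a\frac{\Lambda_F^a(x)}{\Omega_F^a(x)},\qquad h_1(x)=-a\frac{\Omega_F^a(x)}{\Omega_F^a(x+1)}.$$ Moreover, $D_F(c_n^{a;F})=n\,c_n^{a;F}$ for all $n\in\sigma_F$.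
   Context: Shift operators: $\mathfrak{s}_l(p)(x)=p(x+l)$. Charlier polynomials ($a\ne0$): $c_n^a(x)=\frac1{n!}\sum_{j=0}^n(-a)^{n-j}\binom nj\binom xj j!$ for $n\ge 0$, where $\binom{x}{j}j!=x(x-1)\cdots(x-j+1)$. For $F=\{f_1<\cdots<f_k\}$ put $u_F=\sum_{f\in F}f-\binom{k+1}{2}$ (a nonnegative integer) and $\sigma_F=\{u_F,u_F+1,u_F+2,\dots\}\setminus\{u_F+f: f\in F\}$. For $n\in\sigma_F$, $c_n^{a;F}(x)$ is the $(k+1)\times(k+1)$ determinant whose first row is $(c^a_{n-u_F}(x+j))_{j=0}^{k}$ and whose $(i+1)$-th row is $(c^a_{f_i}(x+j))_{j=0}^k$, $i=1,\dots,k$ (it is a polynomial of degree $n$). $\Omega_F^a(x)=\det\big(c_{f_i}^a(x+j-1)\big)_{i,j=1}^k$, and $\Lambda_F^a(x)$ is the $k\times k$ determinant whose $i$-th row is $(c_{f_i}^a(x),c_{f_i}^a(x+1),\dots,c_{f_i}^a(x+k-2),c_{f_i}^a(x+k))$. Both are non-zero polynomials, so $h_{-1},h_0,h_1$ are rational functions of $x$; the eigenvalue equations are identities of rational functions. *)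

(* Defs.v *)
From mathcomp Require Import all_boot all_order all_algebra.
From mathcomp Require Import reals.

Set Implicit Arguments.
Unset Strict Implicit.
Unset Printing Implicit Defensive.

Import Order.TTheory GRing.Theory Num.Theory.
Local Open Scope ring_scope.

Notation "x %:F" := (@FracField.tofrac _ x) (at level 1, format "x %:F") : ring_scope.

(* A finite set F = {f_1 < ... < f_k} of natural numbers is encoded by the
   strictly increasing list [:: f_1; ...; f_k], so k = size F and f_i is
   nth 0 F (i - 1).  Matrix indices below start at 0.                         *)

Section Charlier.
Variable R : realType.
Implicit Types (a : R) (F : seq nat) (n : nat) (p : {poly R}).

Definition shift (l : int) p : {poly R} := p \Po ('X + (l%:~R)%:P).

(* binom(x, j) j! = x (x - 1) ... (x - j + 1) *)
Definition falling j : {poly R} := \prod_(i < j) ('X - (i%:R)%:P).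

Definition charlier a n : {poly R} :=
  (n`!%:R)^-1 *: \sum_(j < n.+1) ((- a) ^+ (n - j) * 'C(n, j)%:R) *: falling j.

(* The subtraction does not truncate when F consists of positive integers,
   since then f_i >= i.                                                       *)
Definition uF F : nat := (\sum_(f <- F) f - 'C((size F).+1, 2))%N.

Definition sigmaF F : pred nat :=
  [pred n | (uF F <= n)%N && (n \notin [seq (uF F + f)%N | f <- F])].

Definition charlierF a F n : {poly R} :=
  \det (\matrix_(i < (size F).+1, j < (size F).+1)
          shift j%:Z (charlier a (nth 0%N ((n - uF F)%N :: F) i))).

Definition Omega a F : {poly R} :=
  \det (\matrix_(i < size F, j < size F) shift j%:Z (charlier a (nth 0%N F i))).

(* The columns are shifted by 0, 1, ..., k - 2, k. *)
Definition Lambda a F : {poly R} :=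
  \det (\matrix_(i < size F, j < size F)
          shift (if (j.+1 < size F)%N then j%:Z else (size F)%:Z)
                (charlier a (nth 0%N F i))).

Definition hm1 a F : {fraction {poly R}} :=
  - 'X%:F * ((shift 1 (Omega a F))%:F / (Omega a F)%:F).

Definition h0 a F : {fraction {poly R}} :=
  ('X + ((size F)%:R + a + (uF F)%:R)%:P)%:F
  - a%:P%:F * ((shift 1 (Lambda a F))%:F / (shift 1 (Omega a F))%:F)
  + a%:P%:F * ((Lambda a F)%:F / (Omega a F)%:F).

Definition h1 a F : {fraction {poly R}} :=
  - a%:P%:F * ((Omega a F)%:F / (shift 1 (Omega a F))%:F).

(* Difference operators with rational coefficients, as maps from polynomials
   to rational functions.                                                     *)
Definition DF a F p : {fraction {poly R}} :=
  hm1 a F * (shift (-1) p)%:F + h0 a F * (shift 0 p)%:F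
  + h1 a F * (shift 1 p)%:F.

Definition eigenfunction (D : {poly R} -> {fraction {poly R}}) (lambda : R) p :
    Prop :=
  p != 0 /\ D p = lambda%:P%:F * p%:F.

End Charlier.

(* Main.v *)
Require Import Defs.
From mathcomp Require Import all_boot all_order all_algebra perm.
From mathcomp Require Import reals.
From mathcomp Require Import ring.

(* Let T be the operator sending q to the Casoratian of q, c_{f_1}, ..., c_{f_k},
   and let D be the Charlier operator, with D c_n = n c_n.  The coefficients
   h_{-1}, h_0, h_1 are chosen exactly so that in D_F T - T (D + u_F) the
   terms in s_{-1}, s_{k+1} and s_k cancel, leaving an operator supported on
   s_0, ..., s_{k-1}.  It annihilates c_{f_1}, ..., c_{f_k}, whose Casoratian
   Omega is non-zero, so it vanishes identically: D_F T = T (D + u_F).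
   Casoratians of polynomials of distinct degrees are non-zero because their
   top coefficient is a Vandermonde determinant in the degrees. *)

Set Implicit Arguments.
Unset Strict Implicit.
Unset Printing Implicit Defensive.

Import Order.TTheory GRing.Theory Num.Theory.
Local Open Scope ring_scope.

Section Casorati.
Variable R : realType.
Implicit Types (p q : {poly R}) (k : nat).

(** * Algebra of the shift operators *)

Lemma shift0 p : shift 0 p = p.
Proof. by rewrite /shift addr0 comp_polyXr. Qed.

Lemma shift_shift l m p : shift l (shift m p) = shift (l + m) p.
Proof.
rewrite /shift -comp_polyA; congr (_ \Po _).
by rewrite comp_polyD comp_polyX comp_polyC -addrA -polyCD -intrD.
Qed.

Lemma shift_det l k (M : 'M[{poly R}]_k) :
  shift l (\det M) = \det (\matrix_(i, j) shift l (M i j)).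
Proof.
rewrite /shift -(det_map_mx (comp_poly ('X + (l%:~R)%:P))).
by congr (\det _); apply/matrixP => i j; rewrite !mxE.
Qed.

Lemma shiftX l : shift l 'X = 'X + (l%:~R)%:P :> {poly R}.
Proof. exact: comp_polyX. Qed.

Lemma shiftC l (c : R) : shift l c%:P = c%:P.
Proof. exact: comp_polyC. Qed.

Lemma shiftD l p q : shift l (p + q) = shift l p + shift l q.
Proof. exact: comp_polyD. Qed.

Lemma shiftM l p q : shift l (p * q) = shift l p * shift l q.
Proof. exact: comp_polyM. Qed.

Lemma shift_sum l (I : finType) (q : I -> {poly R}) :
  shift l (\sum_i q i) = \sum_i shift l (q i).
Proof. by rewrite /shift linear_sum. Qed.

Lemma shift_eq0 l p : (shift l p == 0) = (p == 0).
Proof.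
apply/eqP/eqP => [q0|->]; last by rewrite /shift comp_poly0.
by rewrite -(shift0 p) -(addNr l) -shift_shift q0 /shift comp_poly0.
Qed.

(** * Forward differences *)

Definition delta p := shift 1 p - p.

(** Binomial expansion of (1 + Delta)^n. The number of terms is a free bound [k], so that all
    columns of a Casoratian expand over the same index set. *)
Lemma shift_newton k n p : (n < k)%N ->
  shift n%:Z p = \sum_(l < k) iter l delta p *+ 'C(n, l).
Proof.
elim: n k p => [|n IHn] [//|k] p lt_nk.
  rewrite big_ord_recl /= shift0 big1 ?addr0 //.
rewrite -addn1 PoszD -shift_shift (_ : shift 1 p = p + delta p); last first.
  by rewrite /delta addrC subrK.
rewrite addn1 shiftD (IHn k.+1) ?(ltnW lt_nk) // (IHn k) //.
rewrite !big_ord_recl /= !bin0 -addrA; congr (_ + _).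
rewrite -big_split /=; apply: eq_bigr => i _.
by rewrite -iterS iterSr binS mulrnDr.
Qed.

Lemma delta0 : delta 0 = 0.
Proof. by rewrite /delta /shift comp_poly0 subr0. Qed.

(** The factor ['X] lets the coefficient of degree d - 1 be read at d, which covers d = 0 uniformly.
    Induction writes p = q X + c, where Delta p = (Delta q) X + Delta q + q. *)
Lemma delta_top p d : (size p <= d.+1)%N ->
  (size (delta p) <= d)%N /\ (delta p * 'X)`_d = p`_d *+ d.
Proof.
elim: d p => [|d IHd] p.
  by move/size1_polyC->; rewrite /delta shiftC subrr size_poly0 mul0r coef0 mulr0n.
have [q [c ->]] : exists q c, p = q * 'X + c%:P.
  by elim/poly_ind: p => [|p c _]; [exists 0, 0; rewrite mul0r addr0 | exists p, c].
move=> szp; have szq : (size q <= d.+1)%N.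
  by apply/leq_sizeP=> j lt_dj; have /leq_sizeP/(_ j.+1 lt_dj) := szp;
    rewrite coefD coefMX coefC /= addr0.
have [szdq topq] := IHd q szq.
have -> : delta (q * 'X + c%:P) = delta q * 'X + delta q + q.
  by rewrite /delta shiftD shiftM shiftX shiftC; ring.
split.
  apply: leq_trans (size_polyD _ _) _; rewrite geq_max szq andbT.
  apply: leq_trans (size_polyD _ _) _; rewrite geq_max (leq_trans szdq) // andbT.
  by apply: leq_trans (size_polyMleq _ _) _; rewrite size_polyX addn2.
rewrite coefMX /= 2!coefD topq (leq_sizeP _ _ szdq) // addr0.
by rewrite coefD coefMX coefC /= addr0 mulrSr.
Qed.

Lemma iter_delta_top l p d : (size p <= d.+1)%N ->
  (size (iter l delta p * 'X^l)%R <= d.+1)%N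
  /\ (iter l delta p * 'X^l)`_d = p`_d *+ d ^_ l.
Proof.
elim: l p d => [|l IHl] p d szp; first by rewrite /= mulr1 ffactn0.
rewrite iterSr exprSr mulrA; case: d szp => [|d] szp.
  have [] := delta_top szp; rewrite leqn0 size_poly_eq0 => /eqP-> _.
  by rewrite (iter_fix _ delta0) !mul0r size_poly0 coef0 ffact0n mulr0n.
have [szdp topp] := delta_top szp; have [szi topi] := IHl _ _ szdp.
split.
  by apply: leq_trans (size_polyMleq _ _) _; rewrite size_polyX addn2.
rewrite coefMX /= topi; move: topp; rewrite coefMX /= => ->.
by rewrite ffactnS -mulrnA.
Qed.

(** * Top coefficients of products and determinants *)

Lemma prod_top (I : finType) (A : I -> {poly R}) (d : I -> nat) :
  (forall i, (size (A i) <= (d i).+1)%N) ->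
  (\prod_i A i)`_(\sum_i d i) = \prod_i (A i)`_(d i).
Proof.
move=> szA.
suff [] : (size (\prod_i A i)%R <= (\sum_i d i).+1)%N
  /\ (\prod_i A i)`_(\sum_i d i) = \prod_i (A i)`_(d i) by [].
elim/big_ind3: _ => [|? d1 x ? d2 y [szx topx] [szy topy]|i _] //=.
  by rewrite size_poly1 coef1.
split.
  apply: leq_trans (size_polyMleq _ _) _.
  by rewrite -subn1 leq_subLR; apply: leq_trans (leq_add szx szy) _; rewrite addSn addnS.
rewrite -topx -topy coefM (bigD1 (inord d1)) //= inordK ?ltnS ?leq_addr //.
rewrite addKn big1 ?addr0 // => j; rewrite -val_eqE /= inordK ?ltnS ?leq_addr //.
rewrite neq_ltn => /orP[lt_j|lt_j].
  rewrite [y`__](leq_sizeP _ _ szy) ?mulr0 //.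
  by rewrite ltn_subRL ltn_add2r.
by rewrite [x`__](leq_sizeP _ _ szx) ?mul0r.
Qed.

Lemma det_top k (A : 'M[{poly R}]_k) (d : 'I_k -> nat) :
  (forall i j, (size (A i j) <= (d i).+1)%N) ->
  (\det A)`_(\sum_i d i) = \det (\matrix_(i, j) (A i j)`_(d i)).
Proof.
move=> szA; rewrite coef_sum; apply: eq_bigr => s _.
under [in RHS]eq_bigr do rewrite mxE.
by case: (odd_perm s); rewrite ?expr1 ?expr0 ?mulN1r ?mul1r ?coefN prod_top.
Qed.

Lemma horner_falling l n : (falling R l).[n%:R] = (n ^_ l)%:R.
Proof.
elim: l => [|l IHl]; first by rewrite /falling big_ord0 hornerC ffactn0.
rewrite /falling big_ord_recr /= hornerM -/(falling R l) IHl hornerXsubC ffactnSr natrM.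
have [le_ln|lt_nl] := leqP l n; first by rewrite natrB.
by rewrite ffact_small ?mul0r.
Qed.

Lemma size_falling l : size (falling R l) = l.+1.
Proof. by rewrite size_prod_XsubC /index_enum -enumT size_enum_ord. Qed.

Lemma monic_falling l : falling R l \is monic.
Proof. exact: monic_prod_XsubC. Qed.

(** The l-th falling factorial is monic of degree l, so the matrix is, up to transposition, a
    unitriangular matrix times the Vandermonde matrix of the distinct nodes [d i]. *)
Lemma det_ffact_neq0 k (d : 'I_k -> nat) : injective d ->
  \det (\matrix_(i < k, l < k) (d i ^_ l)%:R) != 0 :> R.
Proof.
move=> inj_d; pose L : 'M[R]_k := \matrix_(l, m) (falling R l)`_m.
have -> : \matrix_(i < k, l < k) (d i ^_ l)%:R
          = (L *m Vandermonde k (\row_i (d i)%:R))^T :> 'M[R]_k.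
  apply/matrixP => i l; rewrite !mxE -horner_falling.
  rewrite (@horner_coef_wide _ k) ?size_falling //.
  by apply: eq_bigr => m _; rewrite !mxE.
rewrite det_tr det_mulmx det_trig; last first.
  by apply/is_trig_mxP => i j lt_ij; rewrite mxE nth_default ?size_falling.
rewrite big1 ?mul1r => [|i _]; last first.
  by rewrite mxE; have /monicP := monic_falling i; rewrite lead_coefE size_falling.
rewrite det_Vandermonde; apply/prodf_neq0 => i _; apply/prodf_neq0 => j lt_ij.
rewrite !mxE subr_eq0 eqr_nat; apply: contraTneq lt_ij => /inj_d->.
by rewrite ltnn.
Qed.

(** * Casoratians and their cofactors *)

Definition casorati k (p : 'I_k -> {poly R}) : {poly R} :=
  \det (\matrix_(i, j) shift j%:Z (p i)).

(* By Newton's formula the Casoratian equals [det (Delta^l p_i)], whose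
   coefficient of degree [\sum_i d_i - 'C(k, 2)] is, up to leading
   coefficients, the Vandermonde-like determinant of the [d_i ^_ l].  *)
Lemma casorati_neq0 k (p : 'I_k -> {poly R}) (d : 'I_k -> nat) :
  injective d -> (forall i, size (p i) = (d i).+1) -> casorati p != 0.
Proof.
move=> inj_d szp.
pose D : 'M[{poly R}]_k := \matrix_(i, l) iter l delta (p i).
have -> : casorati p = \det D.
  (* Newton's formula relates the two matrices by the unitriangular matrix of binomials. *)
  pose N : 'M[{poly R}]_k := \matrix_(j, l) 'C(j, l)%:R.
  have -> : casorati p = \det (D *m N^T).
    congr (\det _); apply/matrixP => i j; rewrite !mxE (shift_newton _ (ltn_ord j)).
    by apply: eq_bigr => l _; rewrite !mxE mulr_natr.
  rewrite det_mulmx det_tr [\det N]det_trig; last first.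
    by apply/is_trig_mxP => i j lt_ij; rewrite mxE bin_small.
  by rewrite big1 ?mulr1 // => i _; rewrite mxE binn.
(* Scaling column l by X^l makes up for the degree lost to Delta^l: all entries of row i now have
   degree at most [d i], as [det_top] requires. *)
have detX : \det D * \prod_(l < k) 'X^l = \det (\matrix_(i, l) (D i l * 'X^l)).
  have -> : \prod_(l < k) 'X^l = \det (diag_mx (\row_(l < k) 'X^l : 'rV[{poly R}]_k)).
    by rewrite det_diag; apply: eq_bigr => l _; rewrite mxE.
  rewrite -det_mulmx mul_mx_diag; congr (\det _).
  by apply/matrixP => i l; rewrite !mxE.
have top i l := @iter_delta_top l (p i) (d i) (eq_leq (szp i)).
apply: contraTneq (det_ffact_neq0 inj_d) => D0.
have: (\det (\matrix_(i, l) (D i l * 'X^l)))`_(\sum_i d i) = 0.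
  by rewrite -detX D0 mul0r coef0.
rewrite det_top => [|i j]; last by rewrite !mxE; case: (top i j).
have -> : \matrix_(i, j) ((\matrix_(i0, l) (D i0 l * 'X^l)) i j)`_(d i)
   = diag_mx (\row_i (p i)`_(d i)) *m \matrix_(i < k, l < k) (d i ^_ l)%:R.
  rewrite mul_diag_mx; apply/matrixP => i j; rewrite !mxE (top i j).2.
  by rewrite mulr_natr.
rewrite det_mulmx det_diag negbK => /eqP; rewrite mulf_eq0 => /orP[] //.
rewrite (_ : (\prod_i _ == 0) = false) //; apply: negbTE; apply/prodf_neq0 => i _; rewrite mxE.
have -> : (p i)`_(d i) = lead_coef (p i) by rewrite lead_coefE szp.
by rewrite lead_coef_eq0 -size_poly_eq0 szp.
Qed.

(** Cofactor of the entry in column j of a row placed on top of the Casorati rows of [p]; it does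
    not depend on that row. *)
Definition casorati_cofactor k (p : 'I_k -> {poly R}) (j : 'I_k.+1) : {poly R} :=
  (-1) ^+ j * \det (\matrix_(i, l) shift (lift j l)%:Z (p i)).

Lemma casorati_expand k (p : 'I_k.+1 -> {poly R}) :
  casorati p = \sum_(j < k.+1) shift j%:Z (p ord0)
                 * casorati_cofactor (fun i => p (lift ord0 i)) j.
Proof.
rewrite /casorati (expand_det_row _ ord0); apply: eq_bigr => j _.
rewrite mxE; congr (_ * (_ * \det _)).
by apply/matrixP => i l; rewrite !mxE.
Qed.

Lemma casorati_cofactor0 k (p : 'I_k -> {poly R}) :
  casorati_cofactor p ord0 = shift 1 (casorati p).
Proof.
rewrite /casorati_cofactor mul1r shift_det; congr (\det _).
by apply/matrixP => i l; rewrite !mxE shift_shift lift0.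
Qed.

Lemma casorati_cofactor_max k (p : 'I_k -> {poly R}) :
  casorati_cofactor p ord_max = (-1) ^+ k * casorati p.
Proof.
congr (_ * \det _); apply/matrixP => i l.
by rewrite !mxE lift_max.
Qed.

Lemma casorati_repeat k (p : 'I_k -> {poly R}) i1 i2 :
  i1 != i2 -> p i1 = p i2 -> casorati p = 0.
Proof.
by move=> ne12 eqp; apply: (determinant_alternate ne12) => j; rewrite !mxE eqp.
Qed.

(* For [k = 0] the index [k.-1] is junk, but both sides are then [1]. *)
Lemma casorati_cofactor_Lambda (a : R) (F : seq nat) :
  casorati_cofactor (fun i : 'I_(size F) => charlier a (nth 0%N F i))
    (inord (size F).-1) = (-1) ^+ (size F).-1 * Lambda a F.
Proof.
have lt_k : ((size F).-1 < (size F).+1)%N by rewrite ltnS leq_pred.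
rewrite /casorati_cofactor inordK //; congr (_ * \det _).
apply/matrixP => i l; rewrite !mxE; congr (shift _ _).
rewrite /= inordK // /bump; move: (nat_of_ord l) (ltn_ord l) => {}l.
case: (size F) => [|k] /=; first by rewrite ltn0.
rewrite !ltnS => le_lk; case: ltnP => [//|le_kl].
by congr (Posz _); apply/eqP; rewrite eqSS eqn_leq le_lk le_kl.
Qed.

(** The hypotheses say that the coefficients of P 0, P (k+2) and P (k+1) vanish after collecting
    terms. The remaining coefficients [e] do not depend on [P]. *)
Lemma sum_reindex3 (V : pzRingType) k (A B C : nat -> V) :
  A 0%N = 0 -> C k = 0 -> B k + (if k is k'.+1 then C k' else 0) = 0 ->
  exists e : nat -> V, forall P : nat -> V,
    \sum_(j < k.+1) (A j * P j + B j * P j.+1 + C j * P j.+2)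
    = \sum_(j < k) e j * P j.+1.
Proof.
move=> A0 Ck BCk; pose C' (j : nat) : V := if j is j'.+1 then C j' else 0.
exists (fun j => A j.+1 + B j + C' j) => P.
have sumC : \sum_(j < k.+1) C j * P j.+2 = \sum_(j < k.+1) C' j * P j.+1.
  by rewrite big_ord_recr big_ord_recl /= Ck !mul0r addr0 add0r.
rewrite !big_split /= sumC big_ord_recl A0 mul0r add0r.
rewrite !big_ord_recr /= (addrA _ _ (B k * _)) addrACA.
rewrite -mulrDl BCk mul0r addr0.
by rewrite -!big_split; apply: eq_bigr => j _ /=; rewrite -!mulrDl.
Qed.

(** * The Charlier operator and its eigenpolynomials *)

Lemma shift_XsubC l (c : R) : shift l ('X - c%:P) = 'X - (c - l%:~R)%:P.
Proof. by rewrite shiftD -polyCN shiftC shiftX -addrA -polyCD -polyCN opprB. Qed.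

Lemma shift1_falling j : shift 1 (falling R j.+1) = ('X + 1) * falling R j.
Proof.
elim: j => [|j IHj].
  by rewrite /falling big_ord_recl !big_ord0 /= subr0 !mulr1 shiftX.
rewrite /falling big_ord_recr /= shiftM -/(falling R j.+1) IHj.
rewrite [X in _ = _ * X]big_ord_recr /= -/(falling R j) -mulrA; congr (_ * (_ * _)).
by rewrite shift_XsubC -natr1 addrK.
Qed.

Lemma shiftN1_falling j : 'X * shift (-1) (falling R j) = falling R j.+1.
Proof.
elim: j => [|j IHj].
  by rewrite /falling big_ord_recl !big_ord0 /= shiftC subr0 mulr1.
rewrite /falling big_ord_recr /= shiftM -/(falling R j) mulrA IHj.
rewrite [in RHS]big_ord_recr /= -/(falling R j.+1); congr (_ * _).
by rewrite shift_XsubC mulrNz opprK natr1.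
Qed.

(** This is D_F for empty F. *)
Definition charlier_op (a : R) p : {poly R} :=
  - 'X * shift (-1) p + ('X + a%:P) * p - a%:P * shift 1 p.

Lemma shift_charlier_op (b : R) l (q : {poly R}) :
  shift l (charlier_op b q)
  = - ('X + (l%:~R)%:P) * shift (l - 1) q + ('X + (l%:~R)%:P + b%:P) * shift l q
    - b%:P * shift (l + 1) q.
Proof.
have shiftN r : shift l (- r) = - shift l r :> {poly R} by exact: linearN.
by rewrite !(shiftD, shiftN, shiftM, shiftC, shiftX, shift_shift).
Qed.

(** The operator is bidiagonal in the falling factorial basis. At j = 0 the index [j.-1] is
    harmless, its coefficient being 0. *)
Lemma charlier_op_falling (a : R) j :
  charlier_op a (falling R j)
  = j%:R *: falling R j - (a * j%:R) *: falling R j.-1.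
Proof.
have fallingS i : falling R i.+1 = falling R i * ('X - i%:R%:P).
  by rewrite {1}/falling big_ord_recr.
rewrite /charlier_op mulNr shiftN1_falling fallingS -!mul_polyC.
case: j => [|j] /=.
  by rewrite /falling big_ord0 shiftC mulr0 polyC0; ring.
by rewrite shift1_falling fallingS -natr1 !(polyCM, polyCD); ring.
Qed.

Lemma charlier_op_sum (a : R) n (c : nat -> R) (p : nat -> {poly R}) :
  charlier_op a (\sum_(j < n) c j *: p j) = \sum_(j < n) c j *: charlier_op a (p j).
Proof.
rewrite /charlier_op /shift !linear_sum !mulr_sumr -sumrN -!big_split /=.
by apply: eq_bigr => j _; rewrite !linearZ /= !scalerDr !scalerAr scalerN scalerAr.
Qed.

Lemma charlier_eigen (a : R) n :
  charlier_op a (charlier a n) = n%:R *: charlier a n.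
Proof.
rewrite /charlier; set c := fun j => (- a) ^+ (n - j) * 'C(n, j)%:R.
have -> : charlier_op a (n`!%:R^-1 *: \sum_(j < n.+1) c j *: falling R j)
    = n`!%:R^-1 *: charlier_op a (\sum_(j < n.+1) c j *: falling R j).
  by rewrite /charlier_op /shift !linearZ /= !scalerDr scalerN !scalerAr.
rewrite charlier_op_sum scalerA mulrC -scalerA; congr (_ *: _).
under eq_bigr do rewrite charlier_op_falling scalerBr !scalerA.
rewrite sumrB [X in _ - X]big_ord_recl mulr0 mulr0 scale0r add0r /=.
apply/eqP; rewrite subr_eq addrC -subr_eq scaler_sumr -sumrB.
rewrite big_ord_recr /= scalerA mulrC subrr addr0.
(* Comparing coefficients leaves the recurrence (n - j) c_j = - a (j + 1) c_(j+1). *)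
apply/eqP; apply: eq_bigr => j _; rewrite scalerA -scalerBl; congr (_ *: _).
have lt_jn := ltn_ord j.
have := congr1 (fun m => m%:R : R) (mul_bin_left n j).
rewrite /c /bump add1n !natrM natrB 1?ltnW // -(subnSK lt_jn) exprS => bin_eq.
transitivity (- a * (- a) ^+ (n - j.+1) * - (j.+1%:R * 'C(n, j.+1)%:R)).
  by rewrite bin_eq; ring.
by ring.
Qed.

Lemma size_charlier (a : R) n : size (charlier a n) = n.+1.
Proof.
rewrite size_scale ?invr_eq0 ?pnatr_eq0 -?lt0n ?fact_gt0 //.
rewrite big_ord_recr /= subnn binn mulr1 scale1r addrC.
rewrite size_polyDl size_falling // ltnS; apply: leq_trans (size_sum _ _ _) _.
apply/bigmax_leqP => j _; apply: leq_trans (size_scale_leq _ _) _.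
by rewrite size_falling.
Qed.

(** Serves both for Omega, with the list [F], and for [charlierF], with n - u_F prepended. *)
Lemma casorati_charlier_neq0 (a : R) k (F : seq nat) :
  k = size F -> uniq F ->
  casorati (fun i : 'I_k => charlier a (nth 0%N F i)) != 0.
Proof.
move=> -> uF; apply: (casorati_neq0 (d := fun i => nth 0%N F i)) => [i j /eqP|i].
  by rewrite nth_uniq // => /eqP/val_inj.
exact: size_charlier.
Qed.

Lemma det_neq0_kernel (K : fieldType) k (M : 'M[K]_k) (e : 'I_k -> K) :
  \det M != 0 -> (forall i, \sum_j e j * M i j = 0) -> e =1 fun=> 0.
Proof.
move=> M0 Me; have /mulKmx uM : M \in unitmx by rewrite unitmxE unitfE.
have Me0 : M *m (\col_j e j) = 0.
  by apply/colP => i; rewrite !mxE -[RHS](Me i); apply: eq_bigr => j _; rewrite mxE mulrC.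
by move=> j; have /colP/(_ j) := uM _ (\col_j e j); rewrite Me0 mulmx0 !mxE.
Qed.

End Casorati.

(** * The intertwining relation and the eigenvalue equation *)

Section Intertwining.
Variables (R : realType) (a : R) (F : seq nat).
Variables (K : fieldType) (iota : {rmorphism {poly R} -> K}).
Hypothesis iota_inj : injective iota.
Hypothesis F_uniq : uniq F.

Let k := size F.
Let p (i : 'I_k) : {poly R} := charlier a (nth 0%N F i).
(** Natural number indices fit [sum_reindex3]. [W] is the operator T, expanded along its first
    row. *)
Let cof (j : nat) : {poly R} := casorati_cofactor p (inord j).
Let W (q : {poly R}) : {poly R} := \sum_(j < k.+1) shift j%:Z q * cof j.

(* [DF_in] is [DF] with [{fraction {poly R}}] replaced by an abstract field:
   on the concrete one, unifying the [0] of its field structure with the [0]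
   of its additive structure diverges, which blocks [field] and [ring]. *)
Definition hm1_in : K := - iota 'X * (iota (shift 1 (Omega a F)) / iota (Omega a F)).

Definition h0_in : K :=
  iota ('X + ((size F)%:R + a + (uF F)%:R)%:P)
  - iota a%:P * (iota (shift 1 (Lambda a F)) / iota (shift 1 (Omega a F)))
  + iota a%:P * (iota (Lambda a F) / iota (Omega a F)).

Definition h1_in : K := - iota a%:P * (iota (Omega a F) / iota (shift 1 (Omega a F))).

Definition DF_in (q : {poly R}) : K :=
  hm1_in * iota (shift (-1) q) + h0_in * iota (shift 0 q) + h1_in * iota (shift 1 q).

Lemma Omega_neq0 : Omega a F != 0.
Proof. exact: casorati_charlier_neq0. Qed.

Lemma charlierF_casorati m :
  \det (\matrix_(i < k.+1, j < k.+1) shift j%:Z (charlier a (nth 0%N (m :: F) i)))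
  = W (charlier a m).
Proof.
rewrite -[LHS]/(casorati (fun i : 'I_k.+1 => charlier a (nth 0%N (m :: F) i))).
rewrite casorati_expand; apply: eq_bigr => j _; rewrite /cof inord_val.
by congr (_ * (_ * \det _)); apply/matrixP => i l; rewrite !mxE.
Qed.

Lemma W_charlier_mem (i : 'I_k) : W (p i) = 0.
Proof.
rewrite -charlierF_casorati.
exact: (@casorati_repeat _ _ (fun l : 'I_k.+1 =>
  charlier a (nth 0%N (nth 0%N F i :: F) l)) ord0 (lift ord0 i)).
Qed.

Lemma iota_eq0 (q : {poly R}) : (iota q == 0) = (q == 0).
Proof. by rewrite -(inj_eq iota_inj) rmorph0. Qed.

(** On an eigenfunction [q], T (D + u_F) q is a scalar multiple of [W q]. The [e j] are chosen
    before [q] and [lambda], so they can be determined from the c_(f_i) and reused for every c_m. *)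
Lemma DF_in_intertwines : exists e : 'I_k -> K,
  forall (q : {poly R}) (lambda : R), charlier_op a q = lambda *: q ->
  DF_in (W q) - iota (lambda + (uF F)%:R)%:P * iota (W q)
  = \sum_(j < k) e j * iota (shift j%:Z q).
Proof.
have Om0 : iota (Omega a F) != 0 by rewrite iota_eq0 Omega_neq0.
have Om1 : iota (shift 1 (Omega a F)) != 0 by rewrite iota_eq0 shift_eq0 Omega_neq0.
have sgn l m : shift l ((-1) ^+ m : {poly R}) = (-1) ^+ m.
  by rewrite -[-1]/(- 1%:P) -polyCN -polyC_exp shiftC.
have cof0 : cof 0 = shift 1 (Omega a F).
  by rewrite /cof (_ : inord 0 = ord0) ?casorati_cofactor0 //;
    apply/val_inj; rewrite /= inordK.
have cofk : cof k = (-1) ^+ k * Omega a F.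
  by rewrite /cof (_ : inord k = ord_max) ?casorati_cofactor_max //;
    apply/val_inj; rewrite /= inordK.
have cofk1 : cof k.-1 = (-1) ^+ k.-1 * Lambda a F := casorati_cofactor_Lambda a F.
(* Column j contributes [A j], [B j], [C j] as coefficients of s_(j-1), s_j, s_(j+1) in D_F T - T (D
   + u_F). *)
pose A j := hm1_in * iota (shift (-1) (cof j)) + iota ('X + j%:R) * iota (cof j).
pose B j := h0_in * iota (cof j) - iota ('X + j%:R + a%:P + (uF F)%:R) * iota (cof j).
pose C j := h1_in * iota (shift 1 (cof j)) + iota a%:P * iota (cof j).
have [] := @sum_reindex3 _ k A B C.
(* The choice of h_(-1) removes s_(-1), and next that of h_1 removes s_(k+1). *)
- rewrite /A cof0 shift_shift shift0 /hm1_in addr0.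
  by field.
- rewrite /C cofk shiftM sgn /h1_in !rmorphM /=.
  by field.
(* The choice of h_0 removes s_k: B_k = -(-1)^k D and C_(k-1) = (-1)^k D. *)
- pose D := iota a%:P * (iota (shift 1 (Lambda a F)) / iota (shift 1 (Omega a F)))
              * iota (Omega a F) - iota a%:P * iota (Lambda a F).
  have -> : B k = - (-1) ^+ k * D.
    rewrite /B /D cofk /h0_in -/k.
    have -> : 'X + k%:R + a%:P + (uF F)%:R
              = 'X + (k%:R + a + (uF F)%:R)%:P :> {poly R}.
      by rewrite !polyCD !polyC_natr !addrA.
    rewrite !rmorphM !rmorphXn !rmorphN1 /=.
    by field; apply/andP.
  (* For k = 0 there is no C_(k-1), but Omega = Lambda = 1 makes D vanish. *)
  case Ek: k => [|k'].
    have F0 : F = [::] by apply: size0nil.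
    rewrite /D /Omega /Lambda F0 /= !det_mx00 [shift 1 1]shiftC polyC1 rmorph1.
    by rewrite divr1 !mulr1 subrr mulr0 addr0.
  move: cofk1; rewrite Ek /= => cofk'.
  rewrite /C cofk' /D shiftM sgn /h1_in exprS !rmorphM !rmorphXn !rmorphN1 /=.
  by field.
move=> e eP; exists (fun j => e j) => q lambda Lq.
(* Indices are offset by one so that s_(-1) becomes [P 0]. *)
pose P j := iota (shift (j%:Z - 1) q).
have PS j : iota (shift j%:Z q) = P j.+1 by rewrite /P -addn1 PoszD addrK.
under [RHS]eq_bigr do rewrite PS.
rewrite -eP /DF_in /W shift0 !shift_sum !rmorph_sum !mulr_sumr -!big_split -sumrB /=.
apply: eq_bigr => j _.
have eig : iota lambda%:P * P j.+1
    = - iota ('X + j%:R) * P j + iota ('X + j%:R + a%:P) * P j.+1 - iota a%:P * P j.+2.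
  have /(congr1 (fun r => iota (shift j%:Z r))) := Lq.
  rewrite shift_charlier_op -mul_polyC shiftM shiftC.
  rewrite !(rmorphM, rmorphD, rmorphN) /= !PS => <-.
  by rewrite -pmulrn polyC_natr addn1.
rewrite /A /B /C; move: (cof j) => c.
rewrite !shiftM !shift_shift (addrC (-1)) (addrC 1) -PoszD addn1.
rewrite !(rmorphM, rmorphD) /= -/(P j) !PS.
apply/eqP; rewrite -subr_eq0; apply/eqP.
transitivity (iota c * (- iota ('X + j%:R) * P j + iota ('X + j%:R + a%:P) * P j.+1
  - iota a%:P * P j.+2 - iota lambda%:P * P j.+1)).
  rewrite !(rmorphD, rmorph_nat) /=; ring.
by rewrite eig subrr mulr0.
Qed.

Lemma DF_in_W m :
  DF_in (W (charlier a m)) = iota (m%:R + (uF F)%:R)%:P * iota (W (charlier a m)).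
Proof.
have [e eP] := DF_in_intertwines; apply/eqP; rewrite -subr_eq0; apply/eqP.
(* Taking q = c_(f_i) makes [W q] a determinant with a repeated row, hence 0. So [e] solves a
   homogeneous linear system of determinant Omega. *)
have e0 : e =1 fun=> 0.
  apply: (@det_neq0_kernel _ _ (\matrix_(i, j) iota (shift j%:Z (p i)))).
    have := Omega_neq0; rewrite -iota_eq0 -det_map_mx.
    by congr (\det _ != 0); apply/matrixP => i j; rewrite !mxE.
  move=> i; under eq_bigr do rewrite mxE.
  rewrite -(eP _ _ (charlier_eigen a (nth 0%N F i))) W_charlier_mem.
  by rewrite /DF_in /shift !comp_poly0 rmorph0 !mulr0 !addr0 subr0.
by rewrite (eP _ _ (charlier_eigen a m)) big1 // => j _; rewrite e0 mul0r.
Qed.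

Lemma DF_in_charlierF n : (uF F <= n)%N ->
  DF_in (charlierF a F n) = iota n%:R%:P * iota (charlierF a F n).
Proof.
move=> le_un; rewrite /charlierF charlierF_casorati DF_in_W.
by rewrite -natrD subnK.
Qed.

End Intertwining.

(** * Eigenvalue equation and non-vanishing of the eigenfunctions *)

Theorem theorem3p3 (R : realType) (a : R) (F : seq nat)
    (ha : a != 0)
    (hF_increasing : sorted ltn F)
    (hF_positive : forall f : nat, f \in F -> (0 < f)%N) :
  forall n : nat, n \in sigmaF F ->
    eigenfunction (DF a F) n%:R (charlierF a F n).
Proof.
move=> n; rewrite inE => /andP[le_un n_notin].
have F_uniq : uniq F := sorted_uniq ltn_trans ltnn hF_increasing.
split; last first.
  have tofrac_inj : injective (@FracField.tofrac {poly R}).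
    by move=> p q /eqP; rewrite tofrac_eq => /eqP.
  exact: (DF_in_charlierF a tofrac_inj F_uniq le_un).
(* The degrees n - u_F, f_1, ..., f_k are distinct because n is not of the form u_F + f. *)
apply: (@casorati_charlier_neq0 _ a _ ((n - uF F)%N :: F)) => //=.
rewrite F_uniq andbT; apply: contra n_notin => nF.
by apply/mapP; exists (n - uF F)%N; rewrite ?subnKC.
Qed.
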